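(* Let $\mathbb{C}$ be a standard Cauchy random variable and define $$V_1=\frac{1}{1+\mathbb{C}},\quad V_{n+1}=\frac{1}{1+V_n},\qquad U_1=\frac{1}{1+\mathbb{C}^2},\quad U_{n+1}=\frac{1}{1+U_n},\qquad n\ge1.$$ Then both sequences of random variables $(1+V_n)_{n\ge1}$ and $(1+U_n)_{n\ge1}$ converge in distribution, as $n\to\infty$, to the constant $\phi=\frac{1+\sqrt5}{2}$.
   Context: A standard Cauchy random variable has density $\frac{1}{\pi(1+x^2)}$, $x\in\mathbb{R}$. The variables $V_n$ are defined almost surely. *)

(* Defs.v *)
From HB Require Import structures.
From mathcomp Require Import all_boot all_order all_algebra.
From mathcomp Require Import all_classical all_reals all_analysis.
From mathcomp Require Import measurable_realfun.
Set Implicit Arguments.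
Unset Strict Implicit.
Unset Printing Implicit Defensive.
Import Order.TTheory GRing.Theory Num.Theory.
Import numFieldNormedType.Exports.
Local Open Scope classical_set_scope.
Local Open Scope ring_scope.

Definition cauchy_pdf (R : realType) (x : R) : R := (pi * (1 + x ^+ 2))^-1.

Definition standard_cauchy (d : measure_display) (T : measurableType d)
    (R : realType) (P : probability T R) (X : {RV P >-> R}) : Prop :=
  forall A : set R, measurable A ->
    distribution P X A = (\int[lebesgue_measure]_(x in A) (cauchy_pdf x)%:E)%E.

Definition cvg_in_distribution (d : measure_display) (T : measurableType d)
    (R : realType) (P : probability T R)
    (X : nat -> {RV P >-> R}) (Y : {RV P >-> R}) : Prop :=
  forall x : R, {for x, continuous (cdf Y)} ->
    cdf (X n) x @[n --> \oo] --> cdf Y x.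

Definition golden_ratio (R : realType) : R := (1 + Num.sqrt 5) / 2.

(* Main.v *)
(** Almost surely the orbit of [x |-> 1 / (1 + x)] never meets the pole [-1] nor
    starts at the repelling fixed point [- phi]: in the case of [V] because all
    its terms are atomless, as images of an atomless variable under injective
    maps, and in the case of [U] because its terms are nonnegative.  In the
    coordinate [z = (1 + x - phi) / (x + phi)], which sends the fixed points
    [phi - 1] and [- phi] to [0] and infinity, the map is multiplication by
    [(1 - phi) / phi], of modulus less than 1; hence [1 + V n] and [1 + U n]
    converge almost surely to [phi], and therefore in distribution. *)
Require Import Defs.
From HB Require Import structures.
From mathcomp Require Import all_boot all_order all_algebra.
From mathcomp Require Import all_classical all_reals all_analysis.
From mathcomp Require Import measurable_realfun.
From mathcomp Require Import ring lra.
Set Implicit Arguments.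
Unset Strict Implicit.
Unset Printing Implicit Defensive.
Import Order.TTheory GRing.Theory Num.Theory.
Import numFieldNormedType.Exports.
Local Open Scope classical_set_scope.
Local Open Scope ring_scope.

Lemma golden_ratio_sqr (R : realType) :
  golden_ratio R ^+ 2 = golden_ratio R + 1.
Proof.
have h5 : Num.sqrt 5 ^+ 2 = 5 :> R by rewrite sqr_sqrtr.
by rewrite /golden_ratio; field: h5.
Qed.

Lemma golden_ratio_gt1 (R : realType) : 1 < golden_ratio R.
Proof.
have : 1 < Num.sqrt 5 :> R by rewrite -[ltLHS]sqrtr1 ltr_sqrt ?ltr1n.
by rewrite /golden_ratio; lra.
Qed.

Lemma golden_recursion_cvg (R : realType) (v : R^nat) :
  (forall n, 1 + v n != 0) -> (forall n, v n.+1 = 1 / (1 + v n)) ->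
  v 0%N != - golden_ratio R ->
  1 + v n @[n --> \oo] --> golden_ratio R.
Proof.
have := golden_ratio_sqr R; have := golden_ratio_gt1 R.
set phi := golden_ratio R => phi1 phi2 v0 vS vphi.
have phi0 : phi != 0 by rewrite gt_eqF//; lra.
pose q := (1 - phi) / phi.
have q1 : `|q| < 1.
  rewrite /q normrM normfV (gtr0_norm (_ : 0 < phi)); last lra.
  by rewrite ltr_pdivrMr ?mul1r; [rewrite ltr_norml; nra | lra].
pose z n := (1 + v n - phi) / (v n + phi).
(* The denominator of [z] never vanishes: since [phi ^+ 2 = phi + 1], one step of the recursion
   multiplies [v n + phi] by the nonzero factor [phi / (1 + v n)]. *)
have vn n : v n + phi != 0.
  elim: n => [|n IH]; first by rewrite addr_eq0.
  have -> : v n.+1 + phi = phi * (v n + phi) / (1 + v n).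
    by rewrite vS; field: phi2; rewrite v0.
  by rewrite !mulf_neq0 ?invr_eq0.
have zE n : z n = z 0%N * q ^+ n.
  elim: n => [|n IH]; first by rewrite expr0 mulr1.
  rewrite exprS mulrCA -IH /z /q.
  have -> : v n.+1 + phi = phi * (v n + phi) / (1 + v n).
    by rewrite vS; field: phi2; rewrite v0.
  have -> : 1 + v n.+1 - phi = (1 - phi) * (1 + v n - phi) / (1 + v n).
    by rewrite vS; field: phi2; rewrite v0.
  by field; rewrite phi0 vn v0.
have z0 : z n @[n --> \oo] --> (0 : R).
  under eq_fun do rewrite zE.
  exact: cvg_geometric.
(* Inverts the coordinate change; [1 - z n] is nonzero because [2 * phi - 1 > 0]. *)
have vz n : 1 + v n = (phi - (1 - phi) * z n) / (1 - z n).
  have -> : 1 - z n = (2 * phi - 1) / (v n + phi).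
    by rewrite /z; field.
  rewrite /z; field; rewrite vn/=.
  by rewrite gt_eqF//; lra.
under eq_fun do rewrite vz.
suff : (phi - (1 - phi) * z n) / (1 - z n) @[n --> \oo] -->
    (phi - (1 - phi) * 0) / (1 - 0) by rewrite mulr0 !subr0 divr1.
apply: cvgM.
  by apply: cvgB; [exact: cvg_cst | apply: cvgM => //; exact: cvg_cst].
apply: cvgV; first by rewrite subr0 oner_neq0.
by apply: cvgB => //; exact: cvg_cst.
Qed.

Section convergence_in_distribution.
Context (d : measure_display) (T : measurableType d) (R : realType)
  (P : probability T R).
Implicit Types X Y : {RV P >-> R}.

(** For [y < x] the events [Y <= y] and [Y = x] are disjoint and lie in [Y <= x]. Letting [y]
    increase to [x], continuity leaves no mass for [Y = x], as [cdf Y x] is finite. *)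
Lemma continuous_cdf_no_atom Y (x : R) : {for x, continuous (cdf Y)} ->
  {ae P, forall w, Y w != x}.
Proof.
move=> cY.
have mx : measurable (Y @^-1` [set x]) by exact: measurable_funPTI.
exists (Y @^-1` [set x]); split => //; last first.
  by move=> w/= /negP; rewrite negbK => /eqP.
have lecdf y : y < x -> (cdf Y y + P (Y @^-1` [set x]) <= cdf Y x)%E.
  move=> yx; rewrite /cdf /distribution /= /pushforward.
  rewrite -measureU//; last 2 first.
  - exact: measurable_funPTI.
  - rewrite -subset0 => w /= []; rewrite in_itv/= => + Yx.
    by rewrite Yx leNgt yx.
  apply: le_measure; rewrite ?inE.
  - by apply: measurableU => //; exact: measurable_funPTI.
  - exact: measurable_funPTI.
  - by move=> w /= [|->]; rewrite !in_itv//= => /le_trans-> //; exact: ltW.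
have fx : cdf Y x \is a fin_num by rewrite fin_num_measure.
have : (cdf Y x + P (Y @^-1` [set x]) <= cdf Y x)%E.
  have cl : (cdf Y y + P (Y @^-1` [set x]))%E @[y --> x^'-] -->
      (cdf Y x + P (Y @^-1` [set x]))%E.
    apply: cvgeD; [|exact: cvg_at_left_filter|exact: cvg_cst].
    by rewrite fin_num_adde_defr.
  rewrite -(cvg_lim _ cl)//; apply: lime_le; first by apply/cvg_ex; eexists; exact: cl.
  by near=> y; apply: lecdf.
rewrite -leeBrDl// subee// => le0.
by apply/eqP; rewrite eq_le le0 measure_ge0.
Unshelve. all: by end_near. Qed.

(* Dominated convergence for the indicators of [X n <= x]: they converge off the
   event [Y = x], which is negligible when [x] is a continuity point. *)
Lemma ae_cvg_in_distribution (X : nat -> {RV P >-> R}) Y :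
  {ae P, forall w, X n w @[n --> \oo] --> Y w} -> cvg_in_distribution X Y.
Proof.
move=> XY x /continuous_cdf_no_atom Yx.
pose A (Z : {RV P >-> R}) := Z @^-1` `]-oo, x].
have mA Z : measurable (A Z) by exact: measurable_funPTI.
have cdfE Z : cdf Z x = (\int[P]_w (\1_(A Z) w)%:E)%E.
  by rewrite integral_indic// setIT.
under eq_fun do rewrite cdfE.
rewrite cdfE.
have [] := @dominated_convergence _ _ _ P setT measurableT
  (fun n w => (\1_(A (X n)) w)%:E) (fun w => (\1_(A Y) w)%:E) (cst 1%E).
- by move=> n; apply/measurable_EFinP; exact: measurable_indic.
- by apply/measurable_EFinP; exact: measurable_indic.
- apply: filterS2 XY Yx => w Xw Yw _; apply: cvg_near_cst.
  have [Yltx|xltY|Yxe] := ltgtP (Y w) x; last by rewrite Yxe eqxx in Yw.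
  + near=> n; rewrite !indicE !mem_set// /A/= in_itv/= ltW//.
    by near: n; exact: (cvgr_lt (Y w)).
  + near=> n; rewrite !indicE !memNset// /A/= in_itv/=; apply/negP.
      by rewrite -ltNge.
    by rewrite -ltNge; near: n; exact: (cvgr_gt (Y w)).
- by apply: finite_measure_integrable_cst.
- by apply: aeW => w n _; rewrite gee0_abs lee_fin indicE ?ler0n// lern1 leq_b1.
- by [].
Unshelve. all: by end_near. Qed.

End convergence_in_distribution.

Section atomless.
Context (d : measure_display) (T : measurableType d) (R : realType)
  (P : probability T R).

Lemma standard_cauchy_no_atom (C : {RV P >-> R}) : standard_cauchy C ->
  forall a, {ae P, forall w, C w != a}.
Proof.
move=> hC a; exists (C @^-1` [set a]); split.
- exact: measurable_funPTI.
- have /= := hC [set a] (measurable_set1 a).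
  by rewrite integral_set1.
- by move=> w/= /negP; rewrite negbK => /eqP.
Qed.

Lemma no_atom_inv1D (X Y : {RV P >-> R}) :
  {ae P, forall w, 1 + X w != 0 -> Y w = 1 / (1 + X w)} ->
  (forall a, {ae P, forall w, X w != a}) ->
  forall a, {ae P, forall w, Y w != a}.
Proof.
move=> XY hX a; near=> w.
have X1 : 1 + X w != 0.
  by rewrite addrC addr_eq0; near: w; exact: hX.
have -> : Y w = 1 / (1 + X w) by move: X1; near: w.
(* The only possible preimage of [a]. For [a = 0] this is the pole -1, so no case split is
   needed. *)
have : X w != a^-1 - 1 by near: w; exact: hX.
apply: contra_neq => <-; rewrite div1r invrK; ring.
Unshelve. all: by end_near. Qed.

End atomless.

(* The sequences are indexed from 1: V 0 and U 0 are unconstrained.  Each V n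
   is a random variable that obeys the recursion almost surely, and only where
   the denominator is nonzero, so the convention 0^-1 = 0 plays no role. *)
Theorem mainTheorem5 (d : measure_display) (T : measurableType d)
    (R : realType) (P : probability T R)
    (C : {RV P >-> R}) (V U : nat -> {RV P >-> R})
    (hC : standard_cauchy C)
    (hV1 : {ae P, forall w, 1 + C w != 0 -> V 1%N w = 1 / (1 + C w)})
    (hVS : forall n : nat, (1 <= n)%N ->
      {ae P, forall w, 1 + V n w != 0 -> V n.+1 w = 1 / (1 + V n w)})
    (hU1 : {ae P, forall w, U 1%N w = 1 / (1 + C w ^+ 2)})
    (hUS : forall n : nat, (1 <= n)%N ->
      {ae P, forall w, U n.+1 w = 1 / (1 + U n w)}) :
  cvg_in_distribution (fun n => (cst 1 \+ V n : {RV P >-> R}))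
    (cst (golden_ratio R) : {RV P >-> R}) /\
  cvg_in_distribution (fun n => (cst 1 \+ U n : {RV P >-> R}))
    (cst (golden_ratio R) : {RV P >-> R}).
Proof.
split; apply: ae_cvg_in_distribution.
- have atomV n a : {ae P, forall w, V n.+1 w != a}.
    elim: n a => [|n IH]; last exact: no_atom_inv1D (hVS _ _) IH.
    exact: no_atom_inv1D hV1 (standard_cauchy_no_atom hC).
  have V0 : {ae P, forall w n, 1 + V n.+1 w != 0}.
    apply/ae_foralln => n; apply: filterS (atomV n (-1)) => w.
    by rewrite [1 + _]addrC addr_eq0.
  have VS : {ae P, forall w n,
      1 + V n.+1 w != 0 -> V n.+2 w = 1 / (1 + V n.+1 w)}.
    by apply/ae_foralln => n; exact: hVS.
  apply: filterS3 V0 VS (atomV 0%N (- golden_ratio R)) => w V0w VSw V1w.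
  (* The recursion starts at index 1, so the limit is taken along the shifted sequence, with initial
     term [V 1]. *)
  rewrite -cvg_shiftS/=.
  by apply: (golden_recursion_cvg (v := fun n => V n.+1 w)) => // n; exact: VSw.
- have US : {ae P, forall w n, U n.+2 w = 1 / (1 + U n.+1 w)}.
    by apply/ae_foralln => n; exact: hUS.
  apply: filterS2 hU1 US => w U1w USw.
  have U0 n : 0 <= U n.+1 w.
    elim: n => [|n IH]; rewrite ?U1w ?USw divr_ge0// addr_ge0//.
    exact: sqr_ge0.
  rewrite -cvg_shiftS/=.
  apply: (golden_recursion_cvg (v := fun n => U n.+1 w)) => // [n|].
    by rewrite gt_eqF// ltr_pwDl.
  (* The repelling fixed point is negative, whereas [U 1] is nonnegative. *)
  rewrite gt_eqF// (lt_le_trans _ (U0 0%N))// oppr_lt0.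
  exact: lt_trans (golden_ratio_gt1 R).
Qed.
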